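(* Let $s\ge 2$ be an integer. The semigroup $LCAT(\Lambda_s^{\mathbb N})$ is an ID semigroup if and only if $s$ is prime.
   Context: $\mathbb N$ includes $0$. $\Lambda_s=\{0,1,\dots,s-1\}$ is identified with the ring $\mathbb Z/s\mathbb Z$ (discrete topology), and $\Lambda_s^{\mathbb N}$ is the space of one-sided sequences $a=a_0a_1a_2\dots$ with the product topology and its coordinatewise $\Lambda_s$-module structure. $\sigma$ is the left shift, $\sigma(a)_k=a_{k+1}$. $CAT(\Lambda_s^{\mathbb N})$ is the set of all continuous maps $\tau:\Lambda_s^{\mathbb N}\to\Lambda_s^{\mathbb N}$ with $\tau\sigma=\sigma\tau$, and $LCAT(\Lambda_s^{\mathbb N})$ is the semigroup (under composition) of those elements of $CAT(\Lambda_s^{\mathbb N})$ that are $\Lambda_s$-linear. A semigroup $\Sigma\subset CAT(\Lambda_s^{\mathbb N})$ is ID if every closed $\Sigma$-invariant proper subset of $\Lambda_s^{\mathbb N}$ is finite; a set $A$ is $\Sigma$-invariant if $\tau(A)\subset A$ for all $\tau\in\Sigma$. *)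

(* Defs.v *)
From HB Require Import structures.
From mathcomp Require Import all_boot all_order all_algebra.
From mathcomp Require Import all_classical all_reals all_analysis.

Set Implicit Arguments.
Unset Strict Implicit.
Unset Printing Implicit Defensive.

Import GRing.Theory.

Local Open Scope classical_set_scope.
Local Open Scope ring_scope.

(* One-sided sequences over Z/sZ. This is meant for 1 < s only: ['Z_s] denotes
   Z/2Z when s is 0 or 1. *)
Definition Lseq (s : nat) : Type := nat -> 'Z_s.

(* Product of the discrete topologies, and the coordinatewise module structure;
   [('Z_s)^o] is the ring seen as a module over itself. *)
HB.instance Definition _ (s : nat) :=
  GRing.Lmodule.copy (Lseq s) (nat -> ('Z_s)^o).
HB.instance Definition _ (s : nat) :=
  Topological.copy (Lseq s) {ptws nat -> discrete_topology 'Z_s}.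

Definition shift (s : nat) (a : Lseq s) : Lseq s := fun k => a k.+1.

Definition CAT (s : nat) : set (Lseq s -> Lseq s) :=
  [set tau | continuous tau /\ tau \o @shift s = @shift s \o tau].
Arguments CAT s : clear implicits.

Structure CAT_semigroup (s : nat) := CATSemigroup {
  smaps : set (Lseq s -> Lseq s);
  smaps_CAT : smaps `<=` CAT s;
  smaps_comp : forall tau1 tau2, smaps tau1 -> smaps tau2 ->
    smaps (tau1 \o tau2)
}.

Definition LCAT_set (s : nat) : set (Lseq s -> Lseq s) :=
  [set tau | CAT s tau /\ linear tau].
Arguments LCAT_set s : clear implicits.

Lemma LCAT_set_CAT (s : nat) : LCAT_set s `<=` CAT s.
Proof. by move=> tau []. Qed.

Lemma LCAT_set_comp (s : nat) (tau1 tau2 : Lseq s -> Lseq s) :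
  LCAT_set s tau1 -> LCAT_set s tau2 -> LCAT_set s (tau1 \o tau2).
Proof.
move=> [[c1 e1] l1] [[c2 e2] l2]; split; first split.
- by move=> x; apply: continuous_comp; [exact: c2|exact: c1].
- by rewrite -compA e2 compA e1.
- by move=> c a b /=; rewrite l2 l1.
Qed.

Definition LCAT (s : nat) : CAT_semigroup s :=
  CATSemigroup (@LCAT_set_CAT s) (@LCAT_set_comp s).

Definition invariant_set (s : nat) (Sigma : CAT_semigroup s)
    (A : set (Lseq s)) : Prop :=
  forall tau, smaps Sigma tau -> tau @` A `<=` A.

Definition ID (s : nat) (Sigma : CAT_semigroup s) : Prop :=
  forall A : set (Lseq s),
    closed A -> invariant_set Sigma A -> A `<` [set: Lseq s] -> finite_set A.

(* Main.v *)
(* If s = p q is composite, the sequences annihilated by q form an infinite,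
   proper, closed invariant set. If s is prime and A is closed, invariant and
   misses w, then A misses a whole cylinder around w, of length n say. For a in
   A, the windows (a_i, ..., a_(i+n-1)) cannot span F^n: otherwise some
   polynomial in the shift would send a into that cylinder. So a satisfies a
   nonzero linear recurrence of length n; there are finitely many of these, and
   each solution is determined by its first n terms. *)
Require Import Defs.
From mathcomp Require Import all_boot all_order all_algebra.
From mathcomp Require Import all_classical all_reals all_analysis.

Set Implicit Arguments.
Unset Strict Implicit.
Unset Printing Implicit Defensive.

Import GRing.Theory.

Local Open Scope classical_set_scope.
Local Open Scope ring_scope.

Lemma Lseq_cvgP (s : nat) (G : set_system (Lseq s)) (a : Lseq s) :
  Filter G -> (G --> a) <-> forall k, G [set b | b k = a k].
Proof.
move=> FG; split.
  move=> /(@pointwise_cvgP _ (discrete_topology 'Z_s) _ _ FG) h k.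
  exact: (h k [set a k] (discrete_set1 _)).
move=> h; apply/(@pointwise_cvgP _ (discrete_topology 'Z_s) _ _ FG) => k.
by apply/discrete_cvg; exact: h.
Qed.

Lemma nbhs_cylinder (s n : nat) (a : Lseq s) :
  nbhs a [set b : Lseq s | forall k, (k < n)%N -> b k = a k].
Proof.
have ca : forall k, nbhs a [set b : Lseq s | b k = a k].
  by apply/(Lseq_cvgP a (nbhs_filter a)).
elim: n => [|n IHn]; first exact: filterS filterT.
apply: filterS (filterI IHn (ca n)) => b [bn bnE] k.
by rewrite ltnS leq_eqVlt => /orP[/eqP -> //|]; exact: bn.
Qed.

(** Choosing one such point of [A] for each [n] gives a sequence that converges to [w]
    coordinatewise. *)
Lemma closed_cylinder (s : nat) (A : set (Lseq s)) (w : Lseq s) :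
  closed A ->
  (forall n, exists2 b, A b & forall k, (k < n)%N -> b k = w k) -> A w.
Proof.
move=> clA Aw.
have /choice[b Ab] : forall n, exists b : Lseq s,
    A b /\ forall k, (k < n)%N -> b k = w k.
  by move=> n; have [b] := Aw n; exists b.
apply: (@closed_cvg _ _ \oo _ b A clA).
  by apply: nearW => n; case: (Ab n).
apply/(Lseq_cvgP w) => k.
by exists k.+1 => // n /= kn; case: (Ab n) => _; exact.
Qed.

(** This is the polynomial $\sum_i f_i\sigma^i$ in the shift. *)
Definition shift_poly (s m : nat) (f : 'I_m -> 'Z_s) : Lseq s -> Lseq s :=
  fun a k => \sum_(i < m) f i * a (k + i)%N.

Lemma shift_poly_LCAT (s m : nat) (f : 'I_m -> 'Z_s) :
  LCAT_set s (shift_poly f).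
Proof.
split; first split.
- move=> a; apply/(Lseq_cvgP _ (fmap_filter _ (nbhs_filter a))) => k.
  apply: filterS (nbhs_cylinder (k + m) a) => b ba /=.
  by apply: eq_bigr => i _; rewrite ba // ltn_add2l.
- apply/funext => a; apply/funext => k; rewrite /= /shift /shift_poly.
  by apply: eq_bigr => i _; rewrite addSn.
- move=> c a b; apply/funext => k; rewrite /shift_poly.
  transitivity (c * (\sum_(i < m) f i * a (k + i)%N)
    + \sum_(i < m) f i * b (k + i)%N) => //.
  rewrite mulr_sumr -big_split; apply: eq_bigr => i _ /=.
  by rewrite mulrDr; congr (_ + _); rewrite mulrCA.
Qed.

(** The ranks of the matrices [M m] of initial vectors are bounded by [n], so some [M m] has maximal
    rank and its row space contains every [v i]. If that space is not everything, a nonzero column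
    of its cokernel is the relation. *)
Lemma span_or_relation (F : fieldType) (n : nat) (v : nat -> 'rV[F]_n) :
  (forall w, exists m (f : 'I_m -> F), w = \sum_(i < m) f i *: v i) \/
  (exists2 c : 'cV[F]_n, c != 0 & forall i, v i *m c = 0).
Proof.
pose M m := \matrix_(i < m) v i.
pose P r := `[< exists m, \rank (M m) = r >].
have exP : exists r, P r by exists (\rank (M 0)); apply/asboolP; exists 0.
have leP r : P r -> (r <= n)%N.
  by move=> /asboolP[m <-]; exact: rank_leq_col.
case: (ex_maxnP exP leP) => r /asboolP[m rm] rmax.
have [fullM|nfullM] := boolP (row_full (M m)).
  left=> w; exists m; have /submxP[D ->] := submx_full w fullM.
  exists (D 0); rewrite mulmx_sum_row; apply: eq_bigr => i _.
  by rewrite rowK.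
right; have vM i : (v i <= M m)%MS.
  (* [M N] contains both the rows of [M m] and [v i]; maximality of the rank makes its row space
     that of [M m]. *)
  set N := maxn m i.+1.
  have sub k l : (k <= l)%N -> (M k <= M l)%MS.
    move=> kl; apply/row_subP => j; rewrite rowK.
    by rewrite -[v j](rowK (fun i : 'I_l => v i) (widen_ord kl j)) row_sub.
  have mN : (M m <= M N)%MS by apply: sub; exact: leq_maxl.
  have iN : (i < N)%N by exact: leq_maxr.
  apply: (@submx_trans _ _ _ _ _ _ (M N)).
    by rewrite -[v i](rowK (fun i : 'I_N => v i) (Ordinal iN)) row_sub.
  rewrite -(geq_leqif (mxrank_leqif_sup mN)) rm.
  by apply: rmax; apply/asboolP; exists N.
have [j cj] : exists j, col j (cokermx (M m)) != 0.
  apply/existsP; apply: contraNT nfullM => /existsPn c0.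
  rewrite -sub1mx submxE mul1mx; apply/eqP/matrixP => i j.
  by have := c0 j; rewrite negbK => /eqP/matrixP/(_ i 0); rewrite !mxE.
exists (col j (cokermx (M m))) => // i.
by have := vM i; rewrite submxE => /eqP vM0; rewrite colE mulmxA vM0 mul0mx.
Qed.

Definition recurrent (F : fieldType) (n : nat) (c : 'cV[F]_n) (a : nat -> F) :=
  forall i, \sum_(j < n) a (i + j)%N * c j 0 = 0.

(** Let [d] be the last index with a nonzero coefficient. Dividing by that coefficient expresses
    each term from index [n] on through earlier ones. *)
Lemma recurrent_eq (F : fieldType) (n : nat) (c : 'cV[F]_n) (a b : nat -> F) :
  c != 0 -> recurrent c a -> recurrent c b ->
  (forall k, (k < n)%N -> a k = b k) -> a =1 b.
Proof.
move=> c0 ca cb ab.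
have [j0 cj0] : exists j, c j 0 != 0.
  apply/existsP; apply: contraNT c0 => /existsPn c0.
  apply/eqP/matrixP => i j; rewrite ord1 mxE.
  by have := c0 i; rewrite negbK => /eqP.
case: (@arg_maxnP _ j0 (fun j => c j 0 != 0) val cj0) => d cd dmax.
elim/ltn_ind => k IHk; have [/ab //|nk] := ltnP k n.
have dk : (d <= k)%N by apply: leq_trans nk; exact: ltnW.
apply: (mulIf cd); rewrite -[k](subnK dk).
(* At position [k - d] the summand of index [d] involves the term [k]; later summands vanish and
   earlier ones agree by induction. *)
have := etrans (ca (k - d)%N) (esym (cb (k - d)%N)).
rewrite (bigD1 d) //= [in RHS](bigD1 d) //=.
rewrite [X in _ + X](eq_bigr (fun j : 'I_n => b (k - d + j)%N * c j 0)).
  by move/addIr.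
move=> j jd; have [->|cj] := eqVneq (c j 0) 0; first by rewrite !mulr0.
rewrite IHk // -[X in (_ < X)%N](subnK dk) ltn_add2l ltn_neqAle jd.
exact: dmax.
Qed.

(* Stated for [pdiv p], which equals p, because ['Z_(pdiv p)] is convertible to
   the field ['F_p] whereas ['Z_p] is not. *)
Lemma LCAT_prime_ID (p : nat) : prime p -> ID (LCAT (pdiv p)).
Proof.
move=> p_pr A clA invA [_ nA].
have [w nAw] : exists w, ~ A w.
  by apply/existsNP => allA; apply: nA => a _; exact: allA.
have [n nAn] : exists n, forall b, A b -> ~ forall k, (k < n)%N -> b k = w k.
  apply: contrapT => /forallNP h; apply/nAw/(closed_cylinder clA) => n.
  by apply: contrapT => /forall2NP hn; apply: (h n) => b Ab bw; case: (hn b).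
have rec a : exists c : 'cV['F_p]_n,
    A a -> c != 0 /\ recurrent c (a : nat -> 'F_p).
  (* Outside [A] the vector 0 is a mere placeholder, so that [choice] applies to all sequences. *)
  have [Aa|nAa] := pselect (A a); last by exists 0.
  pose v i : 'rV['F_p]_n := \row_j a (i + j)%N.
  have [spanv|[c c0 cv]] := span_or_relation v; last first.
    exists c => _; split=> // i; have := cv i => /matrixP/(_ 0 0).
    rewrite !mxE => {2}<-; apply: eq_bigr => j _.
    by rewrite mxE.
  (* The coefficients that write the first [n] terms of [w] through the windows of [a] define a
     shift polynomial sending [a] into the forbidden cylinder. *)
  have [m [f wf]] := spanv (\row_j w j).
  have Af : A (shift_poly f a).
    by apply: (invA _ (shift_poly_LCAT f)); exists a.
  case: (nAn _ Af) => k kn.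
  have := wf => /matrixP/(_ 0 (Ordinal kn)); rewrite mxE => ->.
  rewrite summxE; apply: eq_bigr => i _.
  by rewrite !mxE addnC.
have [c cP] := choice rec.
(* A recurrence together with the initial terms: an injective code of [A] in a finite type. *)
pose g (a : Lseq (pdiv p)) : 'cV['F_p]_n * 'rV['F_p]_n := (c a, \row_j a j).
have injg : {in A &, injective g}.
  move=> a b /set_mem/cP[ca0 ca] /set_mem/cP[_ cb] [cab rab].
  apply/funext/(recurrent_eq ca0 ca); first by rewrite cab.
  move=> k kn; have := rab => /matrixP/(_ 0 (Ordinal kn)).
  by rewrite !mxE.
by rewrite -(eq_finite_set (inj_card_eq injg)); exact: finite_finset.
Qed.

Lemma LCAT_composite_nID (p q : nat) :
  (1 < p)%N -> (1 < q)%N -> ~ ID (LCAT (p * q)).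
Proof.
move=> p1 q1 idpq.
have pq1 : (1 < p * q)%N by apply: (leq_trans p1); rewrite leq_pmulr // ltnW.
have natr0 d : (0 < d < p * q)%N -> (d%:R : 'Z_(p * q)) != 0.
  move=> /andP[d0 dpq]; apply/eqP => /(congr1 val) /=.
  by rewrite val_Zp_nat // modn_small // => d00; rewrite d00 in d0.
have p0 : (p%:R : 'Z_(p * q)) != 0.
  by apply: natr0; rewrite ltnW //= ltn_Pmulr // ltnW.
have q0 : (q%:R : 'Z_(p * q)) != 0.
  by apply: natr0; rewrite ltnW //= ltn_Pmull // ltnW.
pose A := [set a : Lseq (p * q) | forall k, q%:R * a k = 0].
(* Since $qp=0$ and $p\ne 0$, these are infinitely many distinct elements of [A]. *)
pose e (n : nat) : Lseq (p * q) := fun k => if k == n then p%:R else 0.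
have Ae n : A (e n).
  move=> k; rewrite /e; case: eqP => _; last by rewrite mulr0.
  by rewrite -natrM [(q * p)%N]mulnC pchar_Zp.
have finA : finite_set A.
  apply: idpq.
  - move=> a clAa k.
    have /clAa[b [Ab ba]] : nbhs a [set b : Lseq (p * q) | b k = a k].
      by move: k; apply/(Lseq_cvgP a (nbhs_filter a)).
    by rewrite -ba; exact: Ab.
  - move=> tau [_ ltau] _ [a Aa <-] k.
    have qa : q%:R *: a = 0 by apply/funext => j; exact: Aa.
    have t0 : tau 0 = 0.
      have := ltau 1 0 0; rewrite scale1r add0r scale1r => h.
      by apply: (addrI (tau 0)); rewrite -h addr0.
    have := ltau q%:R a 0; rewrite qa t0 !addr0 t0 => h.
    by have := congr1 (fun b : Lseq (p * q) => b k) h.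
  (* The constant sequence 1 is outside [A], as $q\ne 0$. *)
  - split=> // /(_ (fun=> 1) I 0%N); rewrite mulr1.
    exact/eqP.
have inje : {in e @^-1` A &, injective e}.
  move=> i j _ _ /(congr1 (fun b : Lseq (p * q) => b i)); rewrite /e eqxx.
  by case: eqP => // _ /eqP; rewrite (negPf p0).
have preA : e @^-1` A = [set: nat] by apply/seteqP; split=> // n _; exact: Ae.
by have := finite_preimage inje finA; rewrite preA => /infinite_nat.
Qed.

Theorem theorem3p2 (s : nat) (hs : (2 <= s)%N) : ID (LCAT s) <-> prime s.
Proof.
split=> [idS|s_pr]; last by have := LCAT_prime_ID s_pr; rewrite pdiv_id.
apply: contrapT => /negP/primePn[|[p /andP[p1 ps] /dvdnP[q sE]]].
  by rewrite ltnNge hs.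
have q1 : (1 < q)%N by rewrite ltnNge; apply/negP => q1; move: ps;
  rewrite ltnNge sE -{2}[p]mul1n leq_mul2r q1 orbT.
by apply: (LCAT_composite_nID q1 p1); rewrite -sE.
Qed.
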